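(* Let $\mathcal{H}$ be a real Hilbert space and let $f:\mathcal{H}\to\mathbb{R}\cup\{+\infty\}$ be a proper, convex, lower semicontinuous function with $S:=\operatorname{argmin}_{\mathcal{H}} f\neq\emptyset$. Let $\alpha>1$, let $(s_k)_{k\ge0}$ be defined by $s_0:=0$ and $$s_{k+1}:=\frac{\alpha-1+\sqrt{(\alpha-1)^2+4s_k^2}}{2}\quad\forall k\ge0$$ (so that $s_{k+1}^2-(\alpha-1)s_{k+1}=s_k^2$), let $y_0,x_0\in\mathcal{H}$ be arbitrary initial points, and let $(y_k)_{k\ge0}$ be the sequence generated by $$(\forall k\ge0)\quad\begin{cases}y_{k+1}:=\operatorname{prox}_{\frac{s_{k+1}}{\alpha-1}f}(y_k)\\ x_{k+1}:=\left(1-\frac{\alpha-1}{s_{k+1}}\right)x_k+\frac{\alpha-1}{s_{k+1}}y_{k+1}.\end{cases}$$ Then the following statements are true: (i) (summability of function values) $\sum_{k\ge0}s_k\left(f(y_k)-\inf_{\mathcal{H}}f\right)<+\infty$; (ii) (summability of subgradients) there exists a sequence $(\eta_k)_{k\ge0}\subseteq\mathcal{H}$ such that $\eta_k\in\partial f(y_k)$ for every $k\ge0$ and $\sum_{k\ge0}s_k^2\|\eta_k\|^2<+\infty$; in particular, if $f$ is differentiable, then $$\|\nabla f(y_k)\|=o\left(\frac{1}{\sqrt{\sum_{i=0}^k s_i^2}}\right)=o\left(\frac{1}{k\sqrt k}\right)\quad\text{as }k\to+\infty;$$ (iii) (convergence of values towards the minimal value) $f(y_k)-\inf_{\mathcal{H}}f=o\left(\frac{1}{\sum_{i=0}^k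 s_i}\right)=o\left(\frac1{s_k^2}\right)=o\left(\frac1{(k+1)^2}\right)$ as $k\to+\infty$; (iv) the sequence of iterates $(y_k)_{k\ge0}$ converges weakly as $k\to+\infty$, and its limit belongs to $S$.
   Context: For $\mu>0$, $\operatorname{prox}_{\mu f}(u)$ denotes the unique minimizer of $v\mapsto f(v)+\frac1{2\mu}\|v-u\|^2$ over $\mathcal{H}$, and $\partial f$ is the convex subdifferential of $f$.
   Formalization: In (ii), η_k ∈ ∂f(y_k) is stated for every k ≥ 1, and for k = 0 only when ∂f(y_0) is nonempty: y_0 is arbitrary, so ∂f(y_0) may be empty (e.g. f the indicator of {0} on ℝ, y_0 = 1). *)

(* Defs.v *)
From HB Require Import structures.
From mathcomp Require Export all_boot all_order all_algebra.
From mathcomp Require Export sesquilinear.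
From mathcomp Require Export all_classical all_reals all_analysis.
Set Implicit Arguments.
Unset Strict Implicit.
Unset Printing Implicit Defensive.
Import Order.TTheory GRing.Theory Num.Theory numFieldNormedType.Exports.
Local Open Scope classical_set_scope.
Local Open Scope ring_scope.

(* A real Hilbert space is a complete normed module H over R together with an
   inner product [dot : {dot H for idfun}] inducing the norm of H. *)
Definition norm_from_dot (R : realType) (H : completeNormedModType R)
    (dot : {dot H for idfun}) : Prop :=
  forall u : H, dot u u = `|u| ^+ 2.

(* Functions H -> R U {+oo} are encoded as functions to \bar R that never take
   the value -oo. *)
Definition proper_fun (R : realType) (H : Type) (f : H -> \bar R) : Prop :=
  (forall x, f x != -oo%E) /\ exists x, f x != +oo%E.

(* The parameter t is taken in the open interval, so that no product
   0 * (+oo) occurs. *)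
Definition convex_efun (R : realType) (H : lmodType R) (f : H -> \bar R) :
    Prop :=
  forall (x y : H) (t : R), 0 < t < 1 ->
    (f (t *: x + (1 - t) *: y)%R <= t%:E * f x + (1 - t)%:E * f y)%E.

Definition argmin (R : realType) (H : Type) (g : H -> \bar R) : set H :=
  [set x | forall z, (g x <= g z)%E].

(* For f proper, convex and lower semicontinuous and 0 < mu, the set of
   minimizers below is a singleton; otherwise [prox] may pick an arbitrary
   minimizer, or 0 if there is none. *)
Definition prox (R : realType) (H : completeNormedModType R) (mu : R)
    (f : H -> \bar R) (u : H) : H :=
  xget 0 (argmin (fun v : H => f v + ((2 * mu)^-1 * `|v - u| ^+ 2)%:E)%E).

(* When f is proper, this is empty at every x with f x = +oo. *)
Definition subdifferential (R : realType) (H : completeNormedModType R)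
    (dot : {dot H for idfun}) (f : H -> \bar R) (x : H) : set H :=
  [set eta | forall z, (f x + (dot eta (z - x))%:E <= f z)%E].

Definition differentiable_efun (R : realType) (H : completeNormedModType R)
    (f : H -> \bar R) : Prop :=
  (forall x, f x \is a fin_num) /\
  (forall x, differentiable (fine \o f : H -> R^o) x).

(* The Riesz representative of the differential of f at x. *)
Definition gradient (R : realType) (H : completeNormedModType R)
    (dot : {dot H for idfun}) (f : H -> \bar R) (x : H) : H :=
  xget 0 [set g | forall v, 'd (fine \o f : H -> R^o) x v = dot g v].

Definition weak_cvg (R : realType) (H : completeNormedModType R)
    (dot : {dot H for idfun}) (y : nat -> H) (l : H) : Prop :=
  forall v, dot (y n) v @[n --> \oo] --> dot l v.

(* The reading "o(a) = o(b)", from left to right, in a chain of Landau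
   symbols. *)
Definition littleo_incl (R : realType) (a b : nat -> R^o) : Prop :=
  forall u : nat -> R^o, u =o_\oo a -> u =o_\oo b.

(* Main.v *)
Require Import Defs.
From mathcomp Require Import ring lra.
Set Implicit Arguments.
Unset Strict Implicit.
Unset Printing Implicit Defensive.
Import Order.TTheory GRing.Theory Num.Theory numFieldNormedType.Exports.
Local Open Scope classical_set_scope.
Local Open Scope ring_scope.

(** The points [y k] are the iterates of the proximal point algorithm with the
    step sizes [mu k = s k / (alpha - 1)].  The optimality condition of a
    proximal step says that [eta k.+1 = (y k - y k.+1) / mu k.+1] is a
    subgradient of [f] at [y k.+1] ([prox_subgradient]).  The subgradient
    inequality at a minimizer [z], once the square is expanded, becomes
    [[
      |y k.+1 - z|^2 + 2 mu k.+1 (f (y k.+1) - min f)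
                     + mu k.+1 ^2 |eta k.+1|^2  <=  |y k - z|^2
    ]]
    ([fejer]).  Its telescoped sum bounds both series of the theorem.

    The rates come from the two sequences that are summed.  Both
    [f (y k) - min f] and [|eta k|] are nonincreasing (the latter by
    monotonicity of the subdifferential), and a nonincreasing [g] with
    [sum w g] finite and [sum w] infinite satisfies
    [g n * sum_(i <= n) w i --> 0] ([olivier]).  The recurrence for [s]
    telescopes to [sum_(i <= k) s i = s k ^2 / (alpha - 1)], and [s] grows
    linearly, which turns these rates into the explicit ones.  When [f] is
    differentiable, its only subgradient at a point is the gradient.

    Weak convergence follows from Opial's argument: the distances to each
    minimizer converge, so there is at most one weak cluster point among the
    minimizers.  Weak cluster points are taken along ultrafilters, for which the
    pointwise limit of [dot (y n)] is a bounded linear functional, hence is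
    represented by a vector ([riesz]).  Such a cluster point [l] is a minimizer:
    the subgradient [l - p] at [p = prox 1 f l], tested against [y n], gives
    [f p + |l - p|^2 <= min f] in the limit ([weak_limit_argmin]).

    The existence of proximal points and the representation of functionals are
    both instances of one fact: a strongly convex function that is bounded below
    and has a closed epigraph attains its minimum
    ([strongly_convex_minimizer]). *)

(** * Inner products *)

Section InnerProduct.
Context {R : realType} {H : completeNormedModType R} (dot : {dot H for idfun}).
Hypothesis norm_dot : norm_from_dot dot.
Implicit Types u v w : H.

Lemma dotC u v : dot u v = dot v u.
Proof. by rewrite hermitian_subproof expr0 mul1r. Qed.

Lemma dotDl u v w : dot (u + v) w = dot u w + dot v w.
Proof. exact: linearDl. Qed.

Lemma dotZl (a : R) u v : dot (a *: u) v = a * dot u v.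
Proof. exact: linearZl_LR. Qed.

Lemma dotNl u v : dot (- u) v = - dot u v.
Proof. exact: linearNl. Qed.

Lemma dotDr u v w : dot w (u + v) = dot w u + dot w v.
Proof. by rewrite dotC dotDl !(dotC w). Qed.

Lemma dotZr (a : R) u v : dot v (a *: u) = a * dot v u.
Proof. by rewrite dotC dotZl (dotC v). Qed.

Lemma dotNr u v : dot v (- u) = - dot v u.
Proof. by rewrite dotC dotNl (dotC v). Qed.

Lemma sqnormD u v : `|u + v| ^+ 2 = `|u| ^+ 2 + 2 * dot u v + `|v| ^+ 2.
Proof. by rewrite -!norm_dot dotDl !dotDr (dotC v u); ring. Qed.

Lemma sqnormB u v : `|u - v| ^+ 2 = `|u| ^+ 2 - 2 * dot u v + `|v| ^+ 2.
Proof. by rewrite sqnormD dotNr normrN; ring. Qed.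

Lemma dot_le_norm u v : dot u v <= `|u| * `|v|.
Proof.
have : `|u + v| ^+ 2 <= (`|u| + `|v|) ^+ 2.
  by rewrite lerXn2r ?nnegrE ?addr_ge0 // ler_normD.
by rewrite sqnormD sqrrD; lra.
Qed.

Lemma normr_dot_le u v : `|dot u v| <= `|u| * `|v|.
Proof.
by rewrite ler_norml dot_le_norm andbT lerNl -dotNl -(normrN u) dot_le_norm.
Qed.

(** The parallelogram identity, which makes a squared distance strongly
    convex. *)
Lemma sqnorm_mid u v w :
  `|2^-1 *: (u + v) - w| ^+ 2 =
  (`|u - w| ^+ 2 + `|v - w| ^+ 2) / 2 - `|u - v| ^+ 2 / 4.
Proof.
rewrite -!norm_dot !(dotDl, dotNl, dotZl, dotDr, dotNr, dotZr).
rewrite (dotC v u) (dotC w u) (dotC w v); lra.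
Qed.

Lemma dot_le0_eq0 u : dot u u <= 0 -> u = 0.
Proof.
rewrite norm_dot => u0; apply/eqP; rewrite -normr_eq0 -sqrf_eq0.
by rewrite eq_le u0 sqr_ge0.
Qed.

Lemma dot_ext u v : (forall w, dot u w = dot v w) -> u = v.
Proof.
move=> uv; apply/eqP; rewrite -subr_eq0; apply/eqP/dot_le0_eq0.
by rewrite dotDl dotNl uv subrr.
Qed.

End InnerProduct.

(** * Minimizers of strongly convex functions *)

(** Sequential closedness of the epigraph: the form of lower semicontinuity in
    which extended values are only met through real upper bounds. *)
Definition epi_closed (R : realType) (H : completeNormedModType R)
    (F : H -> \bar R) : Prop :=
  forall (v : nat -> H) (b : nat -> R) v0 b0,
    v @ \oo --> v0 -> b @ \oo --> b0 ->
    (forall n, F (v n) <= (b n)%:E)%E -> (F v0 <= b0%:E)%E.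

(** Stated through real upper bounds of the values, so that no arithmetic on
    extended reals is needed. *)
Definition midpoint_strongly_convex (R : realType)
    (H : completeNormedModType R) (kappa : R) (F : H -> \bar R) : Prop :=
  forall u v (a b : R), (F u <= a%:E)%E -> (F v <= b%:E)%E ->
    (F (2^-1 *: (u + v)) <= ((a + b) / 2 - kappa * `|u - v| ^+ 2)%:E)%E.

Section Minimizer.
Context {R : realType} {H : completeNormedModType R}.
Implicit Types F : H -> \bar R.

Lemma lsc_epi_closed F : lower_semicontinuous F -> epi_closed F.
Proof.
move=> lscF v b v0 b0 vv0 bb0 Fvb; rewrite leNgt; apply/negP => b0F.
have [a b0a aF] : exists2 a : R, b0 < a & (a%:E < F v0)%E.
  case: (F v0) b0F => [r| |//].
  - rewrite lte_fin => b0r; exists ((b0 + r) / 2); rewrite ?lte_fin; lra.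
  - by move=> _; exists (b0 + 1); rewrite ?ltry //; lra.
have [V Vv0 VF] := lscF _ _ aF.
have /nbhs_ballP[_ /posnumP[e] eV] := Vv0.
(* The values on V exceed a, while the bounds b n fall below a. *)
have : \forall n \near \oo, (a%:E < (b n)%:E)%E /\ b n < a.
  near=> n; split.
    apply: lt_le_trans (Fvb n); apply: VF.
    by near: n; exact: vv0 Vv0.
  by near: n; exact: (cvgr_lt _ bb0 _ b0a).
move/filter_ex => [n []]; rewrite lte_fin => ab ba.
by have := lt_trans ab ba; rewrite ltxx.
Unshelve. all: by end_near. Qed.

Lemma epi_closedD F (q : H -> R) : (forall v, {for v, continuous q}) ->
  epi_closed F -> epi_closed (fun v => F v + (q v)%:E)%E.
Proof.
move=> cq Fcl v b v0 b0 vv0 bb0 Fvb.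
rewrite -leeBrDr // -EFinB.
apply: (Fcl v (fun n => b n - q (v n))) => //.
  by apply: cvgB => //; apply: continuous_cvg => //; exact: cq.
by move=> n; rewrite EFinB leeBrDr.
Qed.

(** A minimizing sequence is Cauchy, since the midpoint of two near minimizers
    cannot have a value below the infimum. *)
Lemma strongly_convex_minimizer F (kappa m : R) :
  0 < kappa -> (forall v, m%:E <= F v)%E -> (exists v, F v < +oo)%E ->
  epi_closed F -> midpoint_strongly_convex kappa F ->
  argmin F !=set0.
Proof.
move=> kappa0 mF [v1 Fv1] Fcl Fmid.
pose I := ereal_inf (range F).
have IF v : (I <= F v)%E by apply: ereal_inf_lbound; exists v.
have Ifin : I \is a fin_num.
  rewrite fin_numE; apply/andP; split.
    rewrite gt_eqF //; apply: (@lt_le_trans _ _ m%:E); first exact: ltNyr.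
    by apply: le_ereal_inf_tmp => _ [v _ <-].
  by rewrite lt_eqF //; apply: le_lt_trans Fv1.
pose r := fine I; have Ir : I = r%:E by rewrite fineK.
have near_min n : exists v, (F v <= (r + n.+1%:R^-1)%:E)%E.
  have [|_ [v _ <-] vlt] := @lb_ereal_inf_adherent R (range F) n.+1%:R^-1 _ Ifin.
    by rewrite invr_gt0.
  by exists v; rewrite EFinD -Ir ltW.
pose v n := sval (cid (near_min n)).
have Fv n : (F (v n) <= (r + n.+1%:R^-1)%:E)%E by rewrite /v; case: cid.
have dist_v i j : kappa * `|v i - v j| ^+ 2 <= (i.+1%:R^-1 + j.+1%:R^-1) / 2.
  have := le_trans (IF _) (Fmid _ _ _ _ (Fv i) (Fv j)).
  rewrite Ir lee_fin.
  by move: i.+1%:R^-1 j.+1%:R^-1 (`|v i - v j| ^+ 2) => p q w; lra.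
have h0 : n.+1%:R^-1 @[n --> \oo] --> (0 : R) by exact: cvg_harmonic.
have cv : cvg (v @ \oo).
  apply: cauchy_cvg; apply: cauchy_exP => _/posnumP[e].
  have de0 : 0 < kappa * e%:num ^+ 2 by rewrite mulr_gt0 // exprn_gt0.
  have [N _ hN] : \forall n \near \oo, n.+1%:R^-1 < kappa * e%:num ^+ 2.
    exact: (cvgr_lt _ h0 _ de0).
  exists (v N); exists N => // n /= Nn.
  rewrite -ball_normE /ball_ /=.
  rewrite -(@ltr_pXn2r _ 2) ?nnegrE //.
  rewrite -(ltr_pM2l kappa0).
  apply: le_lt_trans (dist_v _ _) _.
  have := hN N (leqnn _); have := hN n Nn; rewrite /=.
  by move: n.+1%:R^-1 N.+1%:R^-1 (kappa * _) => p q w; lra.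
exists (lim (v @ \oo)) => z.
apply: le_trans (IF z); rewrite Ir.
apply: (Fcl v (fun n => r + n.+1%:R^-1)) => //.
by rewrite -[X in _ --> X]addr0; apply: cvgD => //; exact: cvg_cst.
Qed.

End Minimizer.

(** * The proximal map *)

Section Prox.
Context {R : realType} {H : completeNormedModType R} {dot : {dot H for idfun}}.
Hypothesis norm_dot : norm_from_dot dot.
Variable f : H -> \bar R.
Hypotheses (f_proper : proper_fun f) (f_convex : convex_efun f).

Lemma convex_le (u v : H) (a b t : R) : 0 < t < 1 ->
  (f u <= a%:E)%E -> (f v <= b%:E)%E ->
  (f (t *: u + (1 - t) *: v)%R <= (t * a + (1 - t) * b)%:E)%E.
Proof.
move=> t01 ua vb; apply: le_trans (f_convex _ _ t01) _.
case/andP: t01 => /ltW t0 t1; have {t1} t1 : 0 <= 1 - t by rewrite subr_ge0 ltW.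
by rewrite [leRHS]EFinD [X in (_ <= X + _)%E]EFinM [X in (_ <= _ + X)%E]EFinM leeD // lee_wpmul2l // lee_fin.
Qed.

(** The penalty alone provides the strong convexity: a fourth of its
    coefficient, as in the parallelogram identity. *)
Lemma penalized_strongly_convex (kappa : R) (w : H) :
  midpoint_strongly_convex (kappa / 4)
    (fun v => f v + (kappa * `|v - w| ^+ 2)%:E)%E.
Proof.
move=> u v a b.
have t01 : 0 < (2^-1 : R) < 1 by lra.
have half : 1 - 2^-1 = 2^-1 :> R by rewrite [X in X - _]splitr mul1r addrK.
rewrite -[(_ <= a%:E)%E]leeBrDr // -[(_ <= b%:E)%E]leeBrDr // -!EFinB => ua vb.
rewrite -leeBrDr // -EFinB.
have := convex_le t01 ua vb.
rewrite half.
rewrite -(scalerDr 2^-1 u v) => /le_trans; apply.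
by move=> {ua vb}; rewrite lee_fin (sqnorm_mid norm_dot); lra.
Qed.

Lemma prox_minimizes (mu m : R) (u : H) :
  lower_semicontinuous f -> (forall v, m%:E <= f v)%E -> 0 < mu ->
  argmin (fun v : H => f v + ((2 * mu)^-1 * `|v - u| ^+ 2)%:E)%E (prox mu f u).
Proof.
move=> f_lsc mf mu0; rewrite /prox.
have k0 : 0 < (2 * mu)^-1 by rewrite invr_gt0; lra.
case: (@strongly_convex_minimizer R H
  (fun v : H => f v + ((2 * mu)^-1 * `|v - u| ^+ 2)%:E)%E
  ((2 * mu)^-1 / 4) m) => [|v|||| p pmin].
- by rewrite divr_gt0.
- rewrite -[X in (X <= _)%E]adde0 leeD // lee_fin mulr_ge0 ?sqr_ge0 //.
  exact: ltW.
- have [_ [v fv]] := f_proper; exists v.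
  by rewrite lte_add_pinfty ?ltry // ltey.
- apply: epi_closedD; last exact: lsc_epi_closed.
  move=> v; apply: cvgM; first exact: cvg_cst.
  have cn : (fun z : H => `|z - u|) z @[z --> v] --> `|v - u|.
    by apply: cvg_norm; apply: cvgB => //; exact: cvg_cst.
  by rewrite !expr2; apply: cvgM.
- exact: penalized_strongly_convex.
- exact: xgetI pmin.
Qed.

Lemma proper_fineK v : (f v < +oo)%E -> f v = (fine (f v))%:E.
Proof.
by move=> fv; rewrite fineK // fin_numE f_proper.1 -ltey.
Qed.

(** The penalty is finite, so a minimizer with the value +oo would force [f] to
    be +oo everywhere. *)
Lemma argmin_penalized_finite (kappa : R) (u p : H) :
  argmin (fun v : H => f v + (kappa * `|v - u| ^+ 2)%:E)%E p ->
  (f p < +oo)%E.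
Proof.
move=> pmin; have [_ [v fv]] := f_proper.
rewrite ltey; apply/negP => /eqP fp.
have := pmin v; rewrite fp addye // leye_eq => /eqP.
by case: (f v) fv => // r.
Qed.

(** Fermat's rule for the proximal step.  Comparing [p] with [p + t (z - p)]
    and using convexity gives the subgradient inequality up to an error of order
    [t], which is then removed by letting [t] be small. *)
Lemma prox_subgradient (mu : R) (u p : H) : 0 < mu ->
  argmin (fun v : H => f v + ((2 * mu)^-1 * `|v - u| ^+ 2)%:E)%E p ->
  subdifferential dot f p (mu^-1 *: (u - p)).
Proof.
move=> mu0 pmin z.
have fp := proper_fineK (argmin_penalized_finite pmin).
have [fz|] := ltP (f z) +oo%E; last by rewrite leye_eq => /eqP ->; rewrite leey.
rewrite (proper_fineK fz) fp -EFinD lee_fin.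
set a := fine (f p); set b := fine (f z).
have key t : 0 < t < 1 ->
    0 <= b - a + mu^-1 * dot (p - u) (z - p)
         + t * ((2 * mu)^-1 * `|z - p| ^+ 2).
  move=> t01; have [t0 t1] := andP t01.
  have fza : (f z <= b%:E)%E by rewrite (proper_fineK fz).
  have fpa : (f p <= a%:E)%E by rewrite fp.
  have := convex_le t01 fza fpa.
  set w := _ + _ => fw; have := pmin w; rewrite fp -EFinD => h.
  have := le_trans h (leeD fw (lexx _)); rewrite -EFinD lee_fin.
  have -> : w - u = (p - u) + t *: (z - p).
    rewrite /w scalerBl scale1r scalerBr.
    by rewrite addrCA [in RHS]addrAC -!addrA; congr (_ + _); rewrite addrCA addrC -addrA.
  rewrite (sqnormD norm_dot (p - u)) (dotZr dot) normrZ exprMn (gtr0_norm t0) -/a => h2.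
  rewrite -(pmulr_rge0 _ t0).
  have i2 : mu^-1 = 2 * (2 * mu)^-1 by field; lra.
  rewrite i2; move: (2 * mu)^-1 h2 => q h2.
  move: (dot _ _) (`|p - u| ^+ 2) (`|z - p| ^+ 2) h2 => D X Y; lra.
have -> : dot (mu^-1 *: (u - p)) (z - p) = - (mu^-1 * dot (p - u) (z - p)).
  by rewrite dotZl -mulrN -dotNl opprB.
have {key} : 0 <= b - a + mu^-1 * dot (p - u) (z - p).
  move: key; set D := b - a + _; set C := _ * `|_| ^+ 2 => key.
  have C0 : 0 <= C by rewrite mulr_ge0 ?sqr_ge0 // invr_ge0; lra.
  rewrite leNgt; apply/negP => D0.
  (* If D < 0, this t in ]0, 1[ satisfies t * C < - D. *)
  pose t := - D / (2 * (C - D)).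
  have CD : 0 < 2 * (C - D) by lra.
  have /key : 0 < t < 1.
    by rewrite /t divr_gt0 //= ?ltr_pdivrMr //; lra.
  have : t * (2 * (C - D)) = - D by rewrite /t mulfVK // gt_eqF.
  have t0 : 0 < t by rewrite divr_gt0 //; lra.
  nra.
lra.
Qed.

End Prox.

(** * Series with monotone terms and Landau symbols *)

Section RealSequences.
Context {R : realType}.

Lemma sum_le_of_telescope (a b : nat -> R) :
  (forall k, 0 <= a k) -> (forall k, a k.+1 + b k <= a k) ->
  forall n, \sum_(i < n) b i <= a 0%N.
Proof.
move=> a0 ab n; suff : \sum_(i < n) b i + a n <= a 0%N by have := a0 n; lra.
elim: n => [|n IH]; first by rewrite big_ord0 add0r.
by rewrite big_ord_recr /=; have := ab n; lra.
Qed.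

Lemma nneseries_ltoo (b : nat -> R) (C : R) :
  (forall k, 0 <= b k) -> (forall n, \sum_(i < n) b i <= C) ->
  (\sum_(0 <= k <oo) (b k)%:E < +oo)%E.
Proof.
move=> b0 bC; apply: (@le_lt_trans _ _ C%:E); last exact: ltry.
apply: lime_le.
  by apply: is_cvg_nneseries => n _ _; rewrite lee_fin.
by near=> n; rewrite big_mkord sumEFin lee_fin.
Unshelve. all: by end_near. Qed.

(** A weighted form of Olivier's theorem.  By monotonicity,
    [g n * sum_(N < i <= n) w i] is at most a tail of the convergent series, and
    the weights up to [N] make up at most half of the total once [n] is large.
    The index 0 is left out of the monotonicity hypothesis because an
    iterative method starts from an arbitrary point. *)
Lemma olivier (w g : nat -> R) (C : R) :
  (forall k, 0 <= w k) -> (forall k, 0 <= g k) ->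
  (forall k, (0 < k)%N -> g k.+1 <= g k) ->
  (forall n, \sum_(i < n) w i * g i <= C) ->
  (forall A : R, \forall n \near \oo, A <= \sum_(i < n) w i) ->
  g n * \sum_(i < n.+1) w i @[n --> \oo] --> (0 : R).
Proof.
move=> w0 g0 gdec BC Woo.
pose W n := \sum_(i < n) w i; pose B n := \sum_(i < n) w i * g i.
have gle n k : g (n.+1 + k)%N <= g n.+1.
  elim: k => [|k IH]; first by rewrite addn0.
  by rewrite addnS (le_trans _ IH) // gdec // addSn.
(* tail bounds the block of indices N+1, ..., N+1+k. *)
have tail N k : g (N.+1 + k)%N * (W (N.+1 + k).+1 - W N.+1)
    <= B (N.+1 + k).+1 - B N.+1.
  have block j : (j <= k)%N ->
    g (N.+1 + k)%N * (W (N.+1 + j).+1 - W N.+1) <= B (N.+1 + j).+1 - B N.+1.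
    have step i : (i <= k)%N ->
        g (N.+1 + k)%N * w (N.+1 + i)%N <= w (N.+1 + i)%N * g (N.+1 + i)%N.
      move=> ik; rewrite mulrC ler_wpM2l //.
      by rewrite -(subnKC ik) addnA; exact: gle.
    elim: j => [_|j IH jk].
      rewrite addn0 /W /B !(big_ord_recr N.+1) /=.
      by have := step 0%N isT; rewrite addn0; lra.
    rewrite addnS /W /B !(big_ord_recr (N.+1 + j).+1) /= -/(W _) -/(B _).
    by have := IH (ltnW jk); have := step _ jk; rewrite addnS /W /B; lra.
  exact: block.
have Bnd : nondecreasing_seq B.
  apply/nondecreasing_seqP => n; rewrite /B big_ord_recr /= lerDl.
  exact: mulr_ge0.
have Bcv : cvg (B @ \oo).
  apply: nondecreasing_is_cvgn => //; exists C => _ [n _ <-]; exact: BC.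
have Ble n : B n <= lim (B @ \oo) by exact: nondecreasing_cvgn_le.
apply/cvgr0Pnorm_le => e e0.
have [N _ hN] : \forall n \near \oo, lim (B @ \oo) - e / 2 <= B n.
  apply: (cvgr_ge _ Bcv); lra.
near=> n.
have nN : (N.+1 <= n)%N by near: n; exact: nbhs_infty_ge.
have Wn1 : 2 * W N.+1 <= W n.+1.
  near: n; have [M _ hM] := Woo (2 * W N.+1).
  by exists M => // k /= Mk; apply: hM; rewrite /= (leq_trans Mk).
rewrite ger0_norm; last by rewrite mulr_ge0 // sumr_ge0.
rewrite -/(W n.+1).
have := tail N (n - N.+1)%N; rewrite subnKC // => tl.
have := hN N.+1 (leqnSn _) => /= hN1.
have := Ble n.+1 => Bn1.
have := ler_wpM2l (g0 n) Wn1; lra.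
Unshelve. all: by end_near. Qed.

Lemma littleo_inv (g A : nat -> R) : (\forall n \near \oo, 0 < A n) ->
  g n * A n @[n --> \oo] --> (0 : R) ->
  (g : nat -> R^o) =o_\oo ((fun n => (A n)^-1) : nat -> R^o).
Proof.
move=> A0 gA; apply/eqoP => e e0.
move/cvgr0Pnorm_le: gA => /(_ e e0) gA.
near=> n.
have An : 0 < A n by near: n.
have : `|g n * A n| <= e by near: n; exact: gA.
rewrite normrM normfV (gtr0_norm An) -ler_pdivlMr //.
Unshelve. all: by end_near. Qed.

Lemma littleo_incl_le (a b : nat -> R^o) (C : R) : 0 < C ->
  (\forall n \near \oo, `|a n| <= C * `|b n|) -> littleo_incl a b.
Proof.
move=> C0 aCb u /eqoP ua; apply/eqoP => e e0.
have eC : 0 < e / C by rewrite divr_gt0.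
near=> n.
have uan : `|u n| <= e / C * `|a n| by near: n; exact: ua.
have abn : `|a n| <= C * `|b n| by near: n.
apply: (le_trans uan).
apply: (le_trans (ler_wpM2l (ltW eC) abn)).
by rewrite mulrA divfK // gt_eqF.
Unshelve. all: by end_near. Qed.

Lemma littleo_incl_inv (A B : nat -> R) (C : R) : 0 < C ->
  (\forall n \near \oo, 0 < B n <= C * A n) ->
  littleo_incl ((fun n => (A n)^-1) : nat -> R^o)
    ((fun n => (B n)^-1) : nat -> R^o).
Proof.
move=> C0 BA; apply: (littleo_incl_le C0); apply: filterS BA => n /andP[B0 BCA].
have A0 : 0 < A n by rewrite -(pmulr_rgt0 _ C0) (lt_le_trans B0).
rewrite !normfV !gtr0_norm // ler_pdivlMr //.
by rewrite mulrC ler_pdivrMr.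
Qed.

End RealSequences.

(** * The step sizes *)


Section StepSizes.
Context {R : realType}.
Variables (c : R) (s : nat -> R).
Hypotheses (c0 : 0 < c) (s0 : s 0%N = 0).
Hypothesis s_rec : forall k, s k.+1 = (c + Num.sqrt (c ^+ 2 + 4 * s k ^+ 2)) / 2.

Lemma step_sqr k : s k.+1 ^+ 2 = c * s k.+1 + s k ^+ 2.
Proof.
rewrite s_rec.
have : Num.sqrt (c ^+ 2 + 4 * s k ^+ 2) ^+ 2 = c ^+ 2 + 4 * s k ^+ 2.
  by rewrite sqr_sqrtr //; have := sqr_ge0 c; have := sqr_ge0 (s k); lra.
move: (Num.sqrt _) => q; nra.
Qed.

(** The square root is at least [2 * s k], so [s] grows at least linearly. *)
Lemma step_incr k : s k + c / 2 <= s k.+1.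
Proof.
suff : 2 * s k <= Num.sqrt (c ^+ 2 + 4 * s k ^+ 2) by rewrite s_rec; lra.
have := ler_norm (2 * s k) => /le_trans; apply.
rewrite -sqrtr_sqr ler_wsqrtr // exprMn -natrX; have := sqr_ge0 c; lra.
Qed.

Lemma step_ge k : k%:R * (c / 2) <= s k.
Proof.
elim: k => [|k IH]; first by rewrite mul0r s0.
by rewrite -natr1 mulrDl mul1r (le_trans _ (step_incr k)) // lerD2r.
Qed.

Lemma step_ge0 k : 0 <= s k.
Proof. by apply: le_trans (step_ge k); rewrite mulr_ge0 ?ler0n // divr_ge0 // ltW. Qed.

Lemma step_gt0 k : 0 < s k.+1.
Proof. by have := step_ge0 k; have := step_incr k; have := c0; lra. Qed.

(** Telescoping, since [c * s k.+1 = s k.+1 ^+ 2 - s k ^+ 2]. *)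
Lemma sum_steps k : \sum_(i < k.+1) s i = s k ^+ 2 / c.
Proof.
have cn : c != 0 by rewrite gt_eqF.
elim: k => [|k IH]; first by rewrite big_ord1 s0 expr0n mul0r.
by rewrite big_ord_recr /= IH step_sqr; field.
Qed.

(** Since [s i >= i c / 2], the sum is at least [c^2 / 4] times the sum of the
    [i^2], and the latter is at least [k^3 / 3]. *)
Lemma sum_sqr_steps_ge k :
  c ^+ 2 / 12 * k%:R ^+ 3 <= \sum_(i < k.+1) s i ^+ 2.
Proof.
elim: k => [|k IH]; first by rewrite big_ord1 s0 !expr0n mulr0.
rewrite big_ord_recr /= (le_trans _ (lerD IH (lexx _))) //.
have k0 : (0 : R) <= k%:R by rewrite ler0n.
have : (k.+1%:R * (c / 2)) ^+ 2 <= s k.+1 ^+ 2.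
  by rewrite lerXn2r ?nnegrE ?step_ge ?step_ge0 // mulr_ge0 ?ler0n // divr_ge0 // ltW.
rewrite -natr1; move: (k%:R) k0 (s k.+1 ^+ 2) => K K0 S.
have : 0 <= c ^+ 2 * (1 + 2 * K) by rewrite mulr_ge0 ?sqr_ge0 //; lra.
have := sqr_ge0 c; nra.
Qed.

Lemma sum_steps_unbounded (A : R) : \forall n \near \oo, A <= \sum_(i < n) s i / c.
Proof.
near=> n.
have n0 : (0 < n)%N by near: n; exact: nbhs_infty_gt.
have : A + 2 <= n%:R by near: n; exact: nbhs_infty_ger.
rewrite -(prednK n0) -[n.-1.+1%:R]natr1 -mulr_suml sum_steps.
have := step_ge n.-1; move: (n.-1%:R) (s n.-1) => K S KS AK.
have {}KS : K / 2 <= S / c by rewrite ler_pdivlMr // mulrAC -mulrA.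
have -> : S ^+ 2 / c / c = (S / c) ^+ 2 by field; rewrite gt_eqF.
move: (S / c) KS => q qK.
have := sqr_ge0 (q - 1); rewrite sqrrB; lra.
Unshelve. all: by end_near. Qed.

Lemma sum_sqr_steps_unbounded (A : R) : \forall n \near \oo, A <= \sum_(i < n) s i ^+ 2.
Proof.
have d0 : 0 < c ^+ 2 / 12 by rewrite divr_gt0 // exprn_gt0.
near=> n.
have n0 : (0 < n)%N by near: n; exact: nbhs_infty_gt.
have : A / (c ^+ 2 / 12) + 3 <= n%:R by near: n; exact: nbhs_infty_ger.
rewrite -(prednK n0) -[n.-1.+1%:R]natr1.
move=> AK; apply: le_trans (sum_sqr_steps_ge n.-1).
have K0 : (0 : R) <= n.-1%:R by rewrite ler0n.
rewrite mulrC -ler_pdivrMr //.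
move: (n.-1%:R) K0 (A / _) AK => K K0 q qK.
(* That is, K^3 >= 3 K - 2. *)
have : 0 <= (K - 1) ^+ 2 * (K + 2) by rewrite mulr_ge0 ?sqr_ge0 //; lra.
nra.
Unshelve. all: by end_near. Qed.

Lemma step_sqr_ge k : (0 < k)%N -> k.+1%:R ^+ 2 <= 16 / c ^+ 2 * s k ^+ 2.
Proof.
move=> k0; have := step_ge k.
have k1 : (1 : R) <= k%:R by rewrite ler1n.
rewrite -[k.+1%:R]natr1 mulrAC ler_pdivlMr ?exprn_gt0 //.
move: (k%:R) k1 (s k) => K K1 S KS.
have -> : 16 * S ^+ 2 = (4 * S) ^+ 2 by ring.
have Kc : 0 <= (K - 1) * c by rewrite mulr_ge0 ?subr_ge0 // ltW.
have c_ge0 := ltW c0.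
rewrite -exprMn lerXn2r ?nnegrE //; lra.
Qed.

Lemma sqrt_sum_sqr_steps_ge k :
  k%:R * Num.sqrt k%:R
    <= (Num.sqrt (c ^+ 2 / 12))^-1 * Num.sqrt (\sum_(i < k.+1) s i ^+ 2).
Proof.
have d0 : 0 < c ^+ 2 / 12 by rewrite divr_gt0 // exprn_gt0.
rewrite ler_pdivlMl ?sqrtr_gt0 //.
have -> : k%:R * Num.sqrt k%:R = Num.sqrt (k%:R ^+ 3) :> R.
  by rewrite exprSr sqrtrM ?sqr_ge0 // sqrtr_sqr ger0_norm.
by rewrite -sqrtrM ?ler_wsqrtr ?sum_sqr_steps_ge // ltW.
Qed.

End StepSizes.

(** * Weak convergence *)

Section Weak.
Context {R : realType} {H : completeNormedModType R} {dot : {dot H for idfun}}.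
Hypothesis norm_dot : norm_from_dot dot.

Lemma bounded_linear_cvg (phi : H -> R) (M : R) (T : Type)
    (F : set_system T) (FF : Filter F) (v : T -> H) (v0 : H) : 0 < M ->
  (forall u v, phi (u + v) = phi u + phi v) ->
  (forall u, `|phi u| <= M * `|u|) ->
  v x @[x --> F] --> v0 -> phi (v x) @[x --> F] --> phi v0.
Proof.
move=> M0 phiD phiM vv0.
have phi0 : phi 0 = 0 by apply/eqP; rewrite -normr_le0 (le_trans (phiM _)) // normr0 mulr0.
have phiN u : phi (- u) = - phi u.
  by apply/eqP; rewrite -addr_eq0 -phiD addNr phi0.
apply/cvgrPdist_le => e e0.
have eM : 0 < e / M by rewrite divr_gt0.
move/cvgrPdist_le: vv0 => /(_ _ eM); apply: filterS => x.
rewrite -phiN -phiD => h; apply: le_trans (phiM _) _.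
by rewrite mulrC -ler_pdivlMr.
Qed.

(** The Riesz representation theorem.  The representing vector [l] minimizes
    [|v|^2 - 2 phi v], and [phi v = dot l v] is the vanishing of the derivative
    at [l] in the direction [v]. *)
Lemma riesz (phi : H -> R) (M : R) : 0 < M ->
  (forall u v, phi (u + v) = phi u + phi v) ->
  (forall a u, phi (a *: u) = a * phi u) ->
  (forall u, `|phi u| <= M * `|u|) ->
  exists l, forall v, phi v = dot l v.
Proof.
move=> M0 phiD phiZ phiM.
have [|v||v b v0 b0 vv0 bb0 Fvb|u v a b|l lmin] :=
  @strongly_convex_minimizer R H (fun v => (`|v| ^+ 2 - 2 * phi v)%:E)
  (1 / 4) (- M ^+ 2).
- lra.
- (* |v|^2 - 2 M |v| >= - M^2, by completing the square. *)
  rewrite lee_fin; have := le_trans (ler_norm _) (phiM v).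
  have := sqr_ge0 (`|v| - M); rewrite sqrrB; lra.
- by exists 0; rewrite ltry.
- rewrite lee_fin; apply: (ler_cvg_to (f := fun n => `|v n| ^+ 2 - 2 * phi (v n))) bb0 _.
    apply: cvgB; last first.
      by apply: cvgM; [exact: cvg_cst|exact: bounded_linear_cvg phiD phiM vv0].
    by rewrite expr2; under eq_fun do rewrite expr2; apply: cvgM; apply: cvg_norm.
  by near=> n; rewrite -lee_fin; exact: Fvb.
- rewrite !lee_fin phiZ phiD; have := sqnorm_mid norm_dot u v 0; rewrite !subr0; lra.
exists l => v.
apply/eqP; rewrite -subr_eq0 -sqrf_eq0; apply/eqP.
set d := phi v - dot l v.
have key t : 2 * t * d <= t ^+ 2 * `|v| ^+ 2.
  have := lmin (l + t *: v); rewrite lee_fin phiD phiZ (sqnormD norm_dot).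
  rewrite (dotZr dot) normrZ exprMn real_normK ?num_real // /d; lra.
have N0 : 0 <= `|v| ^+ 2 by exact: sqr_ge0.
(* key holds for every t; t = q already forces d = 0. *)
pose q := d / (`|v| ^+ 2 + 1).
have dq : d = q * (`|v| ^+ 2 + 1) by rewrite /q divfK // gt_eqF // ltr_wpDl.
have q0 : q ^+ 2 = 0.
  have := key q; rewrite {1}dq => qq; have := sqr_ge0 q => q2.
  by apply/eqP; rewrite eq_le q2 andbT; move: N0 qq q2; clear; nra.
by rewrite dq exprMn q0 mul0r.
Unshelve. all: by end_near. Qed.

Lemma ultra_cvg_bounded (T : Type) (U : set_system T) (UU : UltraFilter U)
    (u : T -> R) (M : R) :
  (forall n, `|u n| <= M) -> exists p : R, u n @[n --> U] --> p.
Proof.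
move=> uM.
have FM : (u @ U) `[- M, M]%classic.
  by rewrite /= nbhs_simpl /=; apply: filterE => n /=; rewrite in_itv /= -ler_norml.
have [p [_ clp]] := @segment_compact R (- M) M (u @ U) _ FM.
exists p => V Vp.
have [//|UV] := in_ultra_setVsetC (u @^-1` V) UU.
by have [q [nV Vq]] := clp (~` V) V UV Vp.
Qed.

Definition weak_cvg_along (T : Type) (U : set_system T) (y : T -> H) (l : H) :=
  forall v, dot (y n) v @[n --> U] --> dot l v.

(** Weak compactness of balls: the limits of [dot (y n) v] along [U] form a
    bounded linear functional of [v]. *)
Lemma bounded_weak_ultralimit (T : Type) (U : set_system T)
    (UU : UltraFilter U) (y : T -> H) (M : R) :
  (forall n, `|y n| <= M) -> exists l, weak_cvg_along U y l.
Proof.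
move=> yM.
have bnd v n : `|dot (y n) v| <= M * `|v|.
  by apply: le_trans (normr_dot_le norm_dot _ _) _; rewrite ler_wpM2r.
have lims v := cid (ultra_cvg_bounded UU (bnd v)).
pose phi v := sval (lims v).
have phiE v : dot (y n) v @[n --> U] --> phi v by rewrite /phi; case: (lims v).
have uniq (g : T -> R) (a b : R) : g n @[n --> U] --> a -> g n @[n --> U] --> b -> a = b.
  move=> ga gb; exact: (cvg_unique (@norm_hausdorff R R) ga gb).
have [|u v|a u|u|l phil] := @riesz phi (`|M| + 1).
- by rewrite ltr_wpDl.
- apply: uniq (phiE _) _.
  by under eq_fun do rewrite (dotDr dot); apply: cvgD; exact: phiE.
- apply: uniq (phiE _) _.
  by under eq_fun do rewrite (dotZr dot); apply: cvgM; [exact: cvg_cst|exact: phiE].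
- apply: (cvgr_to_le (cvg_norm (phiE u))).
  apply: filterE => n; apply: le_trans (bnd _ _) _.
  by rewrite ler_wpM2r // (le_trans (ler_norm M)) // lerDl.
by exists l => v; rewrite -phil; exact: phiE.
Qed.

(** Opial's lemma.  If [l] and [l'] are weak cluster points in [S], then
    [|y n - l|^2 - |y n - l'|^2] converges, hence so does
    [dot (y n) (l - l')].  Its limit is both [dot l (l - l')] and
    [dot l' (l - l')], so [l = l'].  A bounded sequence with a single weak
    cluster point converges weakly. *)
Lemma opial (y : nat -> H) (S : set H) : S !=set0 ->
  (forall z, S z -> cvg (`|y n - z| @[n --> \oo])) ->
  (forall (U : set_system nat) l, UltraFilter U -> \oo `<=` U ->
     weak_cvg_along U y l -> S l) ->
  exists l, weak_cvg dot y l /\ S l.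
Proof.
move=> [z0 Sz0] ycv yS.
have [M yM] : exists M, forall n, `|y n| <= M.
  have /cvg_seq_bounded[C [_ hC]] := ycv _ Sz0.
  exists (C + 1 + `|z0|) => n; rewrite -{1}(subrK z0 (y n)).
  rewrite (le_trans (ler_normD _ _)) // lerD2r.
  have := hC (C + 1); rewrite ltrDl ltr01 => /(_ isT n I) /=.
  by rewrite normr_id.
have uniq U U' l l' : UltraFilter U -> UltraFilter U' -> \oo `<=` U ->
    \oo `<=` U' -> weak_cvg_along U y l -> weak_cvg_along U' y l' -> l = l'.
  move=> UU UU' oU oU' yl yl'.
  have Sl := yS _ _ UU oU yl; have Sl' := yS _ _ UU' oU' yl'.
  pose a := lim (`|y n - l| @[n --> \oo]); pose a' := lim (`|y n - l'| @[n --> \oo]).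
  have dotE n : dot (y n) (l - l') =
      (`|y n - l'| * `|y n - l'| - `|y n - l| * `|y n - l| + (`|l| ^+ 2 - `|l'| ^+ 2)) / 2.
    by rewrite -!expr2 !(sqnormB norm_dot) (dotDr dot) (dotNr dot); lra.
  have lim_dot : dot (y n) (l - l') @[n --> \oo] -->
      (a' * a' - a * a + (`|l| ^+ 2 - `|l'| ^+ 2)) / 2.
    under eq_fun do rewrite dotE.
    apply: cvgM; last exact: cvg_cst.
    apply: cvgD; last exact: cvg_cst.
    by apply: cvgB; apply: cvgM; exact: ycv.
  have along V m : UltraFilter V -> \oo `<=` V -> weak_cvg_along V y m ->
      dot m (l - l') = (a' * a' - a * a + (`|l| ^+ 2 - `|l'| ^+ 2)) / 2.
    move=> UV oV ym; apply: norm_cvg_unique (ym _) _ => //.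
    by move=> W /lim_dot; exact: oV.
  apply/eqP; rewrite -subr_eq0; apply/eqP/(dot_le0_eq0 norm_dot).
  by rewrite dotDl dotNl (along U) // (along U') // subrr.
have [U [UU oU]] := ultraFilterLemma (_ : ProperFilter \oo).
have [l yl] := bounded_weak_ultralimit UU yM.
exists l; split; last exact: yS yl.
move=> v; apply/cvgrPdist_lt => e e0.
(* If the sequence stays e-far from its limit on the unbounded set A, an
   ultrafilter that contains A produces a second cluster point. *)
pose A := [set n | e <= `|dot l v - dot (y n) v|].
apply: contrapT => nA.
have WF : ProperFilter (within A \oo).
  apply: Build_ProperFilter => // w0; apply: nA.
  move: w0; rewrite /within /=; apply: filterS => n nAn; rewrite ltNge; apply/negP => /nAn [].
have [U' [UU' wU']] := ultraFilterLemma WF.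
have oU' : \oo `<=` U'.
  by move=> B oB; apply: wU'; rewrite /within /=; apply: filterS oB => n Bn _.
have [l' yl'] := bounded_weak_ultralimit UU' yM.
have ll' : l = l' by exact: uniq yl yl'.
have UA : U' A by apply: wU'; rewrite /within /=; apply: filterE => n An.
move/cvgrPdist_lt: (yl' v) => /(_ _ e0); rewrite -ll' => UB.
have [n [Bn An]] := filter_ex (filterI UB UA).
by move: An; rewrite /A /= leNgt Bn.
Qed.

(** With [p = prox 1 f l], the vector [l - p] is a subgradient at [p], so
    [f p + dot (l - p) (y n - p) <= f (y n)].  In the limit this reads
    [f p + |l - p|^2 <= m], which forces [p = l] and [f p = m].  This replaces
    the weak lower semicontinuity of [f]. *)
Lemma weak_limit_argmin (f : H -> \bar R) (m : R) (T : Type)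
    (U : set_system T) (UF : ProperFilter U) (y : T -> H) (l : H) :
  proper_fun f -> convex_efun f -> lower_semicontinuous f ->
  (forall v, m%:E <= f v)%E ->
  (forall e, 0 < e -> \forall n \near U, (f (y n) <= (m + e)%:E)%E) ->
  weak_cvg_along U y l -> argmin f l.
Proof.
move=> f_proper f_convex f_lsc mf fy yl.
have pmin := prox_minimizes norm_dot f_proper f_convex l f_lsc mf ltr01.
set p := prox 1 f l in pmin.
have eta := prox_subgradient norm_dot f_proper f_convex ltr01 pmin.
rewrite invr1 scale1r in eta.
have fp := proper_fineK f_proper (argmin_penalized_finite f_proper pmin).
set a := fine (f p) in fp.
have lim_le e : 0 < e -> a + dot (l - p) (l - p) <= m + e.
  move=> e0.
  have h : a + (dot (y n) (l - p) - dot p (l - p)) @[n --> U] -->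
      a + (dot l (l - p) - dot p (l - p)).
    by apply: cvgD; [exact: cvg_cst|apply: cvgB; [exact: yl|exact: cvg_cst]].
  have -> : dot (l - p) (l - p) = dot l (l - p) - dot p (l - p).
    by rewrite dotDl dotNl.
  apply: (cvgr_to_le h).
  apply: filterS (fy _ e0) => n fyn; rewrite -lee_fin (le_trans _ fyn) //.
  by have := eta (y n); rewrite fp -EFinD dotC dotDl dotNl.
have {lim_le} lim_le : a + dot (l - p) (l - p) <= m.
  exact/ler_addgt0Pr.
have ma : m <= a by rewrite -lee_fin -fp.
have lp : l = p.
  apply/eqP; rewrite -subr_eq0; apply/eqP/(dot_le0_eq0 norm_dot).
  by move: lim_le ma; clear; lra.
move=> z; apply: le_trans (mf z); rewrite lp fp lee_fin.
by move: lim_le; rewrite norm_dot; have := sqr_ge0 `|l - p|; clear; lra.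
Qed.

End Weak.

(** * Subgradients *)

Section Subgradients.
Context {R : realType} {H : completeNormedModType R} {dot : {dot H for idfun}}.
Variable f : H -> \bar R.

Lemma subgradient_monotone (p q eta zeta : H) :
  f p \is a fin_num -> f q \is a fin_num ->
  subdifferential dot f p eta -> subdifferential dot f q zeta ->
  0 <= dot (eta - zeta) (p - q).
Proof.
move=> fp fq /(_ q) + /(_ p); rewrite -(fineK fp) -(fineK fq) -!EFinD !lee_fin.
rewrite !(dotDl, dotNl, dotDr, dotNr); move: (fine _) (fine _) => a b; lra.
Qed.

(** The difference quotients along [v] are at least [dot eta v]; the opposite
    inequality is this one for [- v]. *)
Lemma subgradient_differential (p eta : H) :
  differentiable_efun f -> subdifferential dot f p eta ->
  forall v, 'd (fine \o f : H -> R^o) p v = dot eta v.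
Proof.
move=> [ffin fdiff] peta; set h : H -> R^o := fine \o f.
have ge v : dot eta v <= 'd h p v.
  rewrite -deriveE //.
  have dv : derivable h p v by exact: diff_derivable.
  have := cvg_dnbhs_at_right dv.
  move=> cv; apply: (cvgr_to_ge cv).
  near=> t.
  have t0 : 0 < t by near: t; exact: nbhs_right_gt.
  rewrite /= /GRing.scale /= ler_pdivlMl //.
  have := peta (t *: v + p); rewrite -(fineK (ffin p)) -(fineK (ffin (t *: v + p))) -EFinD.
  by rewrite lee_fin addrK (dotZr dot) lerBrDl.
move=> v; apply/eqP; rewrite eq_le ge andbT.
by have := ge (- v); rewrite linearN (dotNr dot) lerN2.
Unshelve. all: by end_near. Qed.

End Subgradients.

(** * The proximal point algorithm *)

Section ProximalPoint.
Context {R : realType} {H : completeNormedModType R} {dot : {dot H for idfun}}.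
Variables (f : H -> \bar R) (mu : nat -> R) (y : nat -> H).
Hypotheses (norm_dot : norm_from_dot dot) (f_proper : proper_fun f)
  (f_convex : convex_efun f) (f_lsc : lower_semicontinuous f)
  (f_argmin : argmin f !=set0).
Hypotheses (mu0 : mu 0%N = 0) (mu_gt0 : forall k, 0 < mu k.+1).
Hypothesis y_prox : forall k, y k.+1 = prox (mu k.+1) f (y k).

(** The subgradient produced by step [k]; it is one at [y k.+1]. *)
Definition prox_subgrad k : H := (mu k.+1)^-1 *: (y k - y k.+1).

(** Real-valued, so that it is 0 when [f (y 0)] is infinite. *)
Definition gap k : R := fine (f (y k) - ereal_inf (range f))%E.

Lemma argmin_fin_num z : argmin f z -> f z \is a fin_num.
Proof.
move=> zmin; rewrite fin_numE f_proper.1 /=; have [_ [v]] := f_proper.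
by apply: contra => /eqP fz; rewrite -leye_eq -fz zmin.
Qed.

Lemma argmin_inf z : argmin f z -> ereal_inf (range f) = f z.
Proof.
move=> zmin; apply/eqP; rewrite eq_le; apply/andP; split.
  by apply: ereal_inf_lbound; exists z.
by apply: le_ereal_inf_tmp => _ [v _ <-].
Qed.

Lemma iterate_minimizes k :
  argmin (fun v : H => f v + ((2 * mu k.+1)^-1 * `|v - y k| ^+ 2)%:E)%E
    (y k.+1).
Proof.
have [z zmin] := f_argmin.
rewrite y_prox; apply: (@prox_minimizes _ _ dot norm_dot f f_proper f_convex
  _ (fine (f z))) => // v.
by rewrite fineK ?argmin_fin_num.
Qed.

Lemma iterate_fin_num k : f (y k.+1) \is a fin_num.
Proof.
have := proper_fineK f_proper
  (argmin_penalized_finite f_proper (iterate_minimizes k)).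
by move=> ->.
Qed.

Lemma prox_subgradP k : subdifferential dot f (y k.+1) (prox_subgrad k).
Proof. exact: prox_subgradient (iterate_minimizes k). Qed.

Lemma mu_prox_subgrad k : mu k.+1 *: prox_subgrad k = y k - y k.+1.
Proof. by rewrite scalerA divff ?scale1r // gt_eqF. Qed.

Lemma gapE k z : argmin f z -> gap k.+1 = fine (f (y k.+1)) - fine (f z).
Proof.
by move=> zmin; rewrite /gap (argmin_inf zmin) fineB ?iterate_fin_num ?argmin_fin_num.
Qed.

Lemma gap_ge0 k : 0 <= gap k.
Proof.
have [z zmin] := f_argmin.
by rewrite fine_ge0 // (argmin_inf zmin) sube_ge0 ?zmin // argmin_fin_num.
Qed.

(** The subgradient inequality at [z], with
    [y k - z = mu k.+1 *: prox_subgrad k - (z - y k.+1)] expanded. *)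
Lemma fejer k z : argmin f z ->
  `|y k.+1 - z| ^+ 2
    + (2 * (mu k.+1 * gap k.+1) + mu k.+1 ^+ 2 * `|prox_subgrad k| ^+ 2)
  <= `|y k - z| ^+ 2.
Proof.
move=> zmin; have := prox_subgradP k z.
rewrite (gapE _ zmin) -{1}(fineK (iterate_fin_num k)) -{1}(fineK (argmin_fin_num zmin)).
rewrite -EFinD lee_fin -(ler_pM2l (mu_gt0 k)).
have -> : `|y k - z| ^+ 2 = `|mu k.+1 *: prox_subgrad k - (z - y k.+1)| ^+ 2.
  by rewrite mu_prox_subgrad opprB addrA subrK.
rewrite (sqnormB norm_dot (mu k.+1 *: _)) dotZl (normrZ (mu k.+1)) exprMn (gtr0_norm (mu_gt0 k)).
rewrite (distrC z) mulrDr.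
by move: (dot _ _) (fine _) (fine _) (`|_| ^+ 2) (`|_| ^+ 2) => D a b X Y; lra.
Qed.

(** The convention [mu 0 = 0] discards the starting point, where [f] may be
    infinite. *)
Lemma sum_prox_gaps n z : argmin f z ->
  \sum_(i < n) mu i * gap i <= `|y 0%N - z| ^+ 2.
Proof.
move=> zmin; case: n => [|n]; first by rewrite big_ord0 sqr_ge0.
rewrite big_ord_recl mu0 mul0r add0r.
apply: (sum_le_of_telescope (a := fun k => `|y k - z| ^+ 2)
  (b := fun k => mu k.+1 * gap k.+1)) => k; first exact: sqr_ge0.
apply: le_trans (fejer k zmin); rewrite lerD2l.
have : 0 <= mu k.+1 * gap k.+1 by rewrite mulr_ge0 ?gap_ge0 // ltW.
have : 0 <= mu k.+1 ^+ 2 * `|prox_subgrad k| ^+ 2.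
  by rewrite mulr_ge0 ?sqr_ge0.
lra.
Qed.

Lemma sum_sqr_prox_subgrads n z : argmin f z ->
  \sum_(i < n) mu i.+1 ^+ 2 * `|prox_subgrad i| ^+ 2 <= `|y 0%N - z| ^+ 2.
Proof.
move=> zmin.
apply: (sum_le_of_telescope (a := fun k => `|y k - z| ^+ 2)
  (b := fun k => mu k.+1 ^+ 2 * `|prox_subgrad k| ^+ 2)) => k.
  exact: sqr_ge0.
apply: le_trans (fejer k zmin); rewrite lerD2l lerDr mulr_ge0 //.
by rewrite mulr_ge0 ?gap_ge0 // ltW.
Qed.

Lemma gap_decr k : (0 < k)%N -> gap k.+1 <= gap k.
Proof.
case: k => // k _; have [z zmin] := f_argmin; rewrite !(gapE _ zmin) lerD2r.
have := prox_subgradP k.+1 (y k.+1).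
rewrite -mu_prox_subgrad (dotZr dot) norm_dot.
rewrite -(fineK (iterate_fin_num k)) -(fineK (iterate_fin_num k.+1)).
rewrite -EFinD lee_fin; apply: le_trans; rewrite lerDl.
by rewrite mulr_ge0 ?sqr_ge0 // ltW.
Qed.

(** Monotonicity of the subdifferential at two successive iterates gives
    [|eta'|^2 <= dot eta eta'] for their subgradients; conclude by
    Cauchy-Schwarz. *)
Lemma prox_subgrad_decr k : `|prox_subgrad k.+1| <= `|prox_subgrad k|.
Proof.
have := subgradient_monotone (iterate_fin_num k.+1) (iterate_fin_num k)
  (prox_subgradP k.+1) (prox_subgradP k).
rewrite -[y k.+2 - _]opprB -mu_prox_subgrad (dotNr dot) (dotZr dot).
rewrite -mulrN pmulr_rge0 // oppr_ge0 dotDl dotNl norm_dot subr_le0 => h.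
have := le_trans h (dot_le_norm norm_dot _ _).
have [->|/eqP n0] := eqVneq `|prox_subgrad k.+1| 0; first by rewrite normr_ge0.
by rewrite expr2 ler_pM2r // lt_def normr_ge0 andbT; apply/eqP.
Qed.

Hypothesis mu_sum : forall A : R, \forall n \near \oo, A <= \sum_(i < n) mu i.

Lemma mu_ge0 k : 0 <= mu k.
Proof. by case: k => [|k]; rewrite ?mu0 // ltW. Qed.

Lemma gap_sum_cvg0 : gap n * \sum_(i < n.+1) mu i @[n --> \oo] --> (0 : R).
Proof.
have [z zmin] := f_argmin.
apply: (olivier (C := `|y 0%N - z| ^+ 2)) => //.
- exact: mu_ge0.
- exact: gap_ge0.
- exact: gap_decr.
- by move=> n; exact: sum_prox_gaps.
Qed.

Lemma gap_cvg0 e : 0 < e -> \forall n \near \oo, gap n <= e.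
Proof.
move=> e0; move/cvgr0Pnorm_le: gap_sum_cvg0 => /(_ _ e0) [N _ hN].
have [M _ hM] := mu_sum 1; exists (maxn N M) => // n /=.
rewrite geq_max => /andP[Nn Mn].
apply: le_trans (hN n Nn); apply: le_trans (ler_norm _).
by rewrite ler_peMr ?gap_ge0 // hM //= (leq_trans Mn).
Qed.

Lemma proximal_point_weak_cvg : exists l, weak_cvg dot y l /\ argmin f l.
Proof.
have [z0 z0min] := f_argmin; have fz0 := argmin_fin_num z0min.
apply: (opial norm_dot f_argmin) => [z zmin|U l UU oU yl].
  pose d n := `|y n - z|.
  have dd : {homo d : m n / (m <= n)%N >-> n <= m}.
    apply/nonincreasing_seqP => n.
    rewrite -(@ler_pXn2r _ 2) ?nnegrE ?normr_ge0 //.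
    apply: le_trans (fejer n zmin); rewrite lerDl addr_ge0 //.
      by rewrite !mulr_ge0 ?gap_ge0 ?mu_ge0.
    by rewrite mulr_ge0 ?sqr_ge0.
  apply: (nonincreasing_is_cvgn dd).
  by exists 0 => _ [n _ <-]; exact: normr_ge0.
apply: (@weak_limit_argmin R H dot norm_dot f (fine (f z0)) nat U _ y) => //.
  by move=> v; rewrite fineK.
move=> e e0; apply: oU; have [N _ hN] := gap_cvg0 e0.
exists N.+1 => // -[//|n] /= Nn.
rewrite -(fineK (iterate_fin_num n)) lee_fin.
have := hN n.+1 (leqW Nn); rewrite /= (gapE _ z0min); move: (fine _) => a; lra.
Qed.

End ProximalPoint.

(** * Rates and weak convergence of the iterates *)

Theorem theorem9 (R : realType) (H : completeNormedModType R)
    (dot : {dot H for idfun}) (f : H -> \bar R) (alpha : R)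
    (s : nat -> R) (x y : nat -> H) :
  norm_from_dot dot ->
  proper_fun f -> convex_efun f -> lower_semicontinuous f ->
  argmin f !=set0 ->
  1 < alpha ->
  s 0%N = 0 ->
  (forall k, s k.+1 =
     (alpha - 1 + Num.sqrt ((alpha - 1) ^+ 2 + 4 * s k ^+ 2)) / 2) ->
  (forall k, y k.+1 = prox (s k.+1 / (alpha - 1)) f (y k)) ->
  (forall k, x k.+1 = (1 - (alpha - 1) / s k.+1) *: x k
                      + ((alpha - 1) / s k.+1) *: y k.+1) ->
  [/\ (* (i) *)
      (\sum_(0 <= k <oo) (s k)%:E * (f (y k) - ereal_inf (range f)) < +oo)%E,
      (* (ii) *)
      (exists eta : nat -> H,
         [/\ forall k, (0 < k)%N -> subdifferential dot f (y k) (eta k),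
             subdifferential dot f (y 0%N) !=set0 ->
               subdifferential dot f (y 0%N) (eta 0%N)
           & (\sum_(0 <= k <oo) (s k ^+ 2 * `|eta k| ^+ 2)%:E < +oo)%E]) /\
      (differentiable_efun f ->
         let g : nat -> R^o := fun k => `|gradient dot f (y k)| in
         let a : nat -> R^o :=
           fun k => (Num.sqrt (\sum_(i < k.+1) s i ^+ 2))^-1 in
         let b : nat -> R^o := fun k => (k%:R * Num.sqrt k%:R)^-1 in
         [/\ g =o_\oo a, g =o_\oo b & littleo_incl a b]),
      (* (iii) *)
      (forall k, (0 < k)%N -> (f (y k) - ereal_inf (range f))%E \is a fin_num)
      /\
      (let g : nat -> R^o := fun k => fine (f (y k) - ereal_inf (range f))%E in
       let a : nat -> R^o := fun k => (\sum_(i < k.+1) s i)^-1 in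
       let b : nat -> R^o := fun k => (s k ^+ 2)^-1 in
       let c : nat -> R^o := fun k => (k.+1%:R ^+ 2)^-1 : R in
       [/\ g =o_\oo a, g =o_\oo b, g =o_\oo c,
           littleo_incl a b & littleo_incl b c])
    & (* (iv) *)
      exists l : H, weak_cvg dot y l /\ argmin f l].
Proof.
move=> norm_dot f_proper f_convex f_lsc f_argmin alpha1 s0 s_rec y_prox _.
have c0 : 0 < alpha - 1 by rewrite subr_gt0.
move: (alpha - 1) c0 s_rec y_prox => c c0 s_rec y_prox.
pose mu k := s k / c; have cn : c != 0 by rewrite gt_eqF.
have mu0 : mu 0%N = 0 by rewrite /mu s0 mul0r.
have mu_gt0 k : 0 < mu k.+1 by rewrite divr_gt0 // (step_gt0 c0 s0).
have mu_sum := sum_steps_unbounded c0 s0 s_rec.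
have sE k : s k = c * mu k by rewrite /mu mulrC divfK.
have s_ge0 := step_ge0 c0 s0 s_rec.
have [z zmin] := f_argmin.
pose C := `|y 0%N - z| ^+ 2.
(* Any subgradient serves at y 0, because its weight s 0 vanishes. *)
pose eta k := if k is k'.+1 then prox_subgrad mu y k'
  else xget 0 (subdifferential dot f (y 0%N)).
have eta_sub k : (0 < k)%N -> subdifferential dot f (y k) (eta k).
  by case: k => // k _; exact: prox_subgradP.
have sum_eta n : \sum_(i < n) s i ^+ 2 * `|eta i| ^+ 2 <= c ^+ 2 * C.
  case: n => [|n]; first by rewrite big_ord0 mulr_ge0 ?sqr_ge0.
  rewrite big_ord_recl s0 expr0n mul0r add0r.
  under eq_bigr do rewrite sE exprMn -mulrA.
  rewrite -mulr_sumr ler_wpM2l ?sqr_ge0 //.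
  exact: (sum_sqr_prox_subgrads norm_dot f_proper f_convex f_lsc f_argmin).
have gap_fin k : (0 < k)%N -> (f (y k) - ereal_inf (range f))%E \is a fin_num.
  case: k => // k _; rewrite (argmin_inf zmin) fin_numB.
  rewrite (argmin_fin_num f_proper zmin) andbT.
  exact: (iterate_fin_num norm_dot f_proper f_convex f_lsc f_argmin mu_gt0).
split.
- have -> : (fun n => \sum_(0 <= k < n) (s k)%:E * (f (y k) - ereal_inf (range f)))%E
      = (fun n => \sum_(0 <= k < n) (s k * gap f y k)%:E)%E.
    apply/funext => n; apply: eq_bigr => -[_|k _].
      by rewrite s0 mul0e mul0r.
    by rewrite EFinM /gap fineK // gap_fin.
  apply: (nneseries_ltoo (C := c * C)) => [k|n].
    by rewrite mulr_ge0 // (gap_ge0 y f_proper f_argmin).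
  under eq_bigr do rewrite sE -mulrA.
  rewrite -mulr_sumr ler_wpM2l ?(ltW c0) //.
  exact: (sum_prox_gaps norm_dot f_proper f_convex f_lsc f_argmin).
- split.
    exists eta; split => //.
      by move=> [e e_sub]; exact: xgetI e_sub.
    apply: (nneseries_ltoo (C := c ^+ 2 * C)) => // k.
    by rewrite mulr_ge0 ?sqr_ge0.
  move=> f_diff g a b.
  have gE k : (0 < k)%N -> g k = `|eta k|.
    move=> /eta_sub /(subgradient_differential f_diff) eta_diff.
    rewrite /g /gradient (xget_unique 0 (x := eta k)) // => h hdiff.
    by apply: (dot_ext norm_dot) => v; rewrite -hdiff eta_diff.
  have ab : littleo_incl a b.
    apply: (littleo_incl_inv (C := (Num.sqrt (c ^+ 2 / 12))^-1)).
      by rewrite invr_gt0 sqrtr_gt0 divr_gt0 // exprn_gt0.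
    near=> k; have k0 : (0 < k)%N by near: k; exact: nbhs_infty_gt.
    by rewrite sqrt_sum_sqr_steps_ge // andbT mulr_gt0 ?sqrtr_gt0 ?ltr0n.
  have ga : g =o_\oo a.
    apply: littleo_inv.
      near=> k; have k0 : (0 < k)%N by near: k; exact: nbhs_infty_gt.
      rewrite sqrtr_gt0 -(prednK k0) big_ord_recr /=.
      by rewrite ltr_wpDl ?exprn_gt0 ?(step_gt0 c0 s0) // sumr_ge0 // => i _; exact: sqr_ge0.
    have : `|eta n| ^+ 2 * \sum_(i < n.+1) s i ^+ 2 @[n --> \oo] --> (0 : R).
      apply: (olivier (w := fun i => s i ^+ 2) (g := fun i => `|eta i| ^+ 2)
        (C := c ^+ 2 * C)) => //.
      - by move=> k; exact: sqr_ge0.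
      - case=> // k _; rewrite lerXn2r ?nnegrE //.
        exact: (prox_subgrad_decr norm_dot f_proper f_convex f_lsc f_argmin).
      - exact: (sum_sqr_steps_unbounded c0 s0 s_rec).
    move/(continuous_cvg _ (@sqrt_continuous R 0)); rewrite sqrtr0.
    apply: cvg_trans; apply: near_eq_cvg.
    near=> k; have k0 : (0 < k)%N by near: k; exact: nbhs_infty_gt.
    by rewrite /= sqrtrM ?sqr_ge0 // sqrtr_sqr normr_id gE.
  by split => //; exact: ab.
- split=> // g a b d.
  have sum_pos k : (0 < k)%N -> 0 < \sum_(i < k.+1) s i.
    case: k => // k _; rewrite (sum_steps c0 s0 s_rec).
    by rewrite divr_gt0 // exprn_gt0 // (step_gt0 c0 s0).
  have sqr_pos k : (0 < k)%N -> 0 < s k ^+ 2.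
    by case: k => // k _; rewrite exprn_gt0 // (step_gt0 c0 s0).
  have ab : littleo_incl a b.
    apply: (littleo_incl_inv (C := c)) => //.
    near=> k; have k0 : (0 < k)%N by near: k; exact: nbhs_infty_gt.
    by rewrite sqr_pos // (sum_steps c0 s0 s_rec) mulrC divfK // lexx.
  have bd : littleo_incl b d.
    apply: (littleo_incl_inv (C := 16 / c ^+ 2)).
      by rewrite divr_gt0 // exprn_gt0.
    near=> k; have k0 : (0 < k)%N by near: k; exact: nbhs_infty_gt.
    by rewrite (step_sqr_ge c0 s0 s_rec) // andbT exprn_gt0 // ltr0n.
  have ga : g =o_\oo a.
    apply: littleo_inv.
      near=> k; apply: sum_pos; near: k; exact: nbhs_infty_gt.
    have := gap_sum_cvg0 norm_dot f_proper f_convex f_lsc f_argmin mu0 mu_gt0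
      y_prox mu_sum.
    move/(cvgM (cvg_cst c)); rewrite mulr0.
    apply: cvg_trans; apply: near_eq_cvg; apply: filterE => k.
    by rewrite /= -mulr_suml mulrCA [c * _]mulrC divfK.
  by split => //; [exact: ab|apply: bd; exact: ab].
- exact: (proximal_point_weak_cvg norm_dot f_proper f_convex f_lsc f_argmin
    mu0 mu_gt0 y_prox mu_sum).
Unshelve. all: by end_near. Qed.
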